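(* Let $L$ be a strongly continuous domain. Then $(L,\sigma_s(L))$ is a locally compact sober space. If moreover $L$ has a smallest element, then $(L,\sigma_s(L))$ is compact.
   Context: A dcpo is a poset in which every directed subset (directed sets are nonempty) has a supremum. For $x\in L$ and $A\subseteq L$: $\uparrow x=\{y\in L: x\le y\}$, $\uparrow A=\bigcup_{a\in A}\uparrow a$; an upper set is a set $U$ with $U=\uparrow U$. Strong Scott topology: a subset $U\subseteq L$ is strongly Scott open if $U$ is an upper set and for every directed $D\subseteq L$ and every $x\in L$, $\bigcap_{d\in D}\uparrow d\cap\uparrow x\subseteq U$ implies $\uparrow d\cap\uparrow x\subseteq U$ for some $d\in D$. Let $\sigma^s(L)$ be the set of all strongly Scott open subsets. It is closed under binary intersections, and the strong Scott topology $\sigma_s(L)$ is the topology having $\sigma^s(L)$ as a base. A dcpo $L$ is a strongly continuous domain if for every $U\in\sigma_s(L)$ and $x\in U$ there is $u\in U$ with $x\in\mathrm{int}_{\sigma_s(L)}\uparrow u\subseteq\uparrow u\subseteq U$ (i.e. $(L,\sigma_s(L))$ is a C-space). Compactness means every open cover has a finite subcover (no Hausdorff condition). A space is locally compact if every point has a neighborhood basis of compact sets. A nonempty subset $A$ of a space is irreducible if for all closed $B,C$, $A\subseteq B\cup C$ implies $A\subseteq B$ or $A\subseteq C$. A space is sober if every irreducible closed set is the closure of a unique point. *)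

(* Defs.v *)
From HB Require Import structures.
From mathcomp Require Import all_boot all_order.
From mathcomp Require Import all_classical.
From mathcomp Require Import topology_structure compact.

Set Implicit Arguments.
Unset Strict Implicit.
Unset Printing Implicit Defensive.

Import Order.TTheory.

Local Open Scope classical_set_scope.

Section Poset.
Context {d : Order.disp_t} {L : porderType d}.
Implicit Types (x y z : L) (A D U : set L).

Definition up x : set L := [set y | (x <= y)%O].

Definition up_set A : set L := \bigcup_(a in A) up a.

Definition upper_set U : Prop := U = up_set U.

Definition directed D : Prop :=
  D !=set0 /\
  forall x y, D x -> D y -> exists2 z, D z & (x <= z)%O /\ (y <= z)%O.

Definition strongly_scott_open U : Prop :=
  upper_set U /\
  forall D x, directed D -> \bigcap_(e in D) up e `&` up x `<=` U ->
    exists2 e, D e & up e `&` up x `<=` U.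

Lemma strongly_scott_openT : strongly_scott_open [set: L].
Proof.
split; first by apply/seteqP; split=> // x _; exists x => //; exact: lexx.
by move=> D x [[e De] _] _; exists e.
Qed.

Lemma upper_setP U :
  upper_set U <-> forall x y, U x -> (x <= y)%O -> U y.
Proof.
split=> [-> x y [a Ua ax] xy|Uup]; first by exists a => //; exact: le_trans xy.
apply/seteqP; split=> [x Ux|y [x Ux]]; last exact: Uup.
by exists x => //; exact: lexx.
Qed.

Lemma strongly_scott_openI : setI_closed strongly_scott_open.
Proof.
move=> U V [/upper_setP uU oU] [/upper_setP uV oV]; split.
  by apply/upper_setP => x y [Ux Vx] xy; split; [exact: uU xy|exact: uV xy].
move=> D x dD; rewrite subsetI => -[DU DV].
have [e De eU] := oU D x dD DU; have [f Df fV] := oV D x dD DV.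
have [g Dg [eg fg]] := dD.2 _ _ De Df.
by exists g => // y [gy xy]; split; [apply: eU|apply: fV];
  split=> //; apply: le_trans gy.
Qed.

End Poset.

Definition dcpo {d : Order.disp_t} (L : porderType d) : Prop :=
  forall D : set L, directed D -> exists s : L, isLub D s.

(* An alias of the carrier: a partial order does not determine a unique
   topology, so the instance below is attached to [strong_scott L], not [L]. *)
Definition strong_scott (L : Type) : Type := L.

Section StrongScottTopology.
Context {d : Order.disp_t} {L : porderType d}.
Local Notation S := (strong_scott L).

HB.instance Definition _ := Order.POrder.on S.

Let base_cover :
  \bigcup_(U in @strongly_scott_open _ S) id U = [set: S].
Proof.
apply/seteqP; split=> // x _.
by exists setT => //; exact: strongly_scott_openT.
Qed.

Let base_join (U V : set S) (x : S) :
  strongly_scott_open U -> strongly_scott_open V -> id U x -> id V x ->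
  exists W, [/\ strongly_scott_open W, id W x & id W `<=` id U `&` id V].
Proof.
by move=> oU oV Ux Vx; exists (U `&` V); split=> //;
  exact: strongly_scott_openI.
Qed.

HB.instance Definition _ :=
  @isBaseTopological.Build S (set S) strongly_scott_open id
    base_cover base_join.

End StrongScottTopology.

Definition strongly_continuous_domain {d : Order.disp_t} (L : porderType d) :
    Prop :=
  dcpo L /\
  forall (U : set (strong_scott L)) (x : strong_scott L), open U -> U x ->
    exists u : strong_scott L, [/\ U u, interior (up u) x & up u `<=` U].

(* [cover_compact] is used rather than the filter-based [compact], whose
   equivalence with it is only available for pointed spaces; the library's
   [locally_compact] asks for closed compact neighbourhoods, which is not what
   is meant in a non-Hausdorff space. *)
Definition locally_compact_space (T : topologicalType) : Prop :=
  forall (x : T) (N : set T), nbhs x N ->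
    exists K : set T, [/\ nbhs x K, cover_compact K & K `<=` N].

Definition irreducible_set {T : topologicalType} (A : set T) : Prop :=
  A !=set0 /\
  forall B C : set T, closed B -> closed C -> A `<=` B `|` C ->
    A `<=` B \/ A `<=` C.

Definition sober_space (T : topologicalType) : Prop :=
  forall A : set T, closed A -> irreducible_set A ->
    exists! x : T, A = closure [set x].

(* Main.v *)
Require Import Defs.
From mathcomp Require Import all_boot all_order finmap.
From mathcomp Require Import all_classical.
From mathcomp Require Import topology_structure compact.

(** Strongly Scott open sets are upper sets, hence so are all open sets.  A
principal filter [up x] is therefore compact: the member of an open cover that
contains [x] already contains [up x].  In a strongly continuous domain the
filters [up u] form neighbourhood bases, which gives local compactness, and the
whole space is [up bot] as soon as there is a least element [bot].

For sobriety, let [A] be closed and irreducible, and let [D] be the set of the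
[u] such that the interior of [up u] meets [A].  Irreducibility and strong
continuity make [D] directed ([directed_approximants]), so it has a supremum
[s].  Every neighbourhood of a point of [A] contains an element of [D], hence
contains [s]; so [A] lies in the closure of [s].  Conversely [s] belongs to
[A], because [A] is closed under directed suprema ([closed_directed_sup]).
Uniqueness of [s] is the T0 property: the closure of a point is its principal
ideal ([closure_pointE]). *)

Import Order.TTheory.

Local Open Scope classical_set_scope.

Section StrongScott.
Context {d : Order.disp_t} {L : porderType d}.
Local Notation S := (strong_scott L).
Implicit Types (x y s : S) (U V A D : set S).

Lemma strongly_scott_open_open U : strongly_scott_open U -> open U.
Proof.
move=> oU; exists [set U]; first by move=> V ->.
by rewrite bigcup_set1.
Qed.

Lemma open_base U x : open U -> U x ->
  exists V, [/\ strongly_scott_open V, V x & V `<=` U].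
Proof.
move=> [B Bsub <-] [V BV Vx]; exists V; split=> //; first exact: Bsub.
by move=> y Vy; exists V.
Qed.

Lemma open_upper U x y : open U -> U x -> (x <= y)%O -> U y.
Proof.
move=> oU Ux xy; have [V [[/upper_setP uV _] Vx VU]] := open_base U x oU Ux.
by apply: VU; apply: uV xy.
Qed.

Lemma closed_lower A x y : closed A -> A y -> (x <= y)%O -> A x.
Proof.
move=> cA Ay xy; apply: contrapT => nAx.
by apply: (open_upper (~` A) x y _ nAx xy Ay); exact: closed_openC.
Qed.

Lemma cover_compact_up x : cover_compact (up x : set S).
Proof.
move=> I J f fop cov; have [i Ji fi_x] := cov x (lexx x).
exists [fset i]%fset; first by move=> j; rewrite !inE => /eqP ->.
move=> y xy; exists i; first by rewrite /= inE.
exact: open_upper (fop i Ji) fi_x xy.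
Qed.

(** Were [s] outside [A], it would have a strongly Scott open neighbourhood [V]
that avoids [A].  The strong Scott condition at [s]
itself is vacuous; applied to [D] and an element [e] of [D], for which
[up s `&` up e] is still [up s], it puts an upper bound in [D] of two elements
of [D] into [V]. *)
Lemma closed_directed_sup A D s :
  closed A -> directed D -> D `<=` A -> isLub D s -> A s.
Proof.
move=> cA dD DA [_ sleast]; apply: contrapT => nAs.
have [V [[/upper_setP uV oV] Vs VA]] :=
  open_base (~` A) s (closed_openC cA) nAs.
have [e De] := dD.1.
have [c Dc cV] : exists2 c, D c & up c `&` up e `<=` V.
  apply: oV => // y [Dy _]; apply: uV Vs _.
  by apply: sleast => c; exact: Dy.
have [g Dg [cg eg]] := dD.2 _ _ Dc De.
by apply: (VA g); [exact: cV|exact: DA].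
Qed.

(** If every [up e `&` up x] with [e] in [D] contains a point below [s], then
[s] bounds [D] and [x] from above, so it lies in the whole intersection. *)
Lemma strongly_scott_openC_down s :
  strongly_scott_open ([set y | ~ (y <= s)%O] : set S).
Proof.
split.
  by apply/upper_setP => x y nxs xy ys; apply: nxs; exact: le_trans ys.
move=> D x [[e0 De0] _] DxU; apply: contrapT => nex.
have below e : D e -> (e <= s)%O /\ (x <= s)%O.
  move=> De; apply: contrapT => nes; apply: nex; exists e => // y [ey xy] ys.
  by apply: nes; split; exact: le_trans ys.
apply: (DxU s) => //; split; last exact: (below e0 De0).2.
by move=> e De; exact: (below e De).1.
Qed.

Lemma closure_pointE s : closure [set s] = [set y | (y <= s)%O].
Proof.
apply/seteqP; split=> y.
  move=> cly; apply: contrapT => nys.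
  have [|z [-> nss]] := cly [set z | ~ (z <= s)%O]; last exact: nss (lexx s).
  apply: open_nbhs_nbhs; split=> //.
  exact/strongly_scott_open_open/strongly_scott_openC_down.
move=> ys; apply: closed_lower ys; first exact: closed_closure.
exact: subset_closure.
Qed.

Lemma closure_point_inj s y : closure [set s] = closure [set y] -> s = y.
Proof.
rewrite !closure_pointE => /seteqP[sy ys]; apply/le_anti/andP.
by split; [exact: sy (lexx s)|exact: ys (lexx y)].
Qed.

End StrongScott.

Lemma irreducible_meetI (T : topologicalType) (A U V : set T) :
  irreducible_set A -> open U -> open V ->
  A `&` U !=set0 -> A `&` V !=set0 -> A `&` (U `&` V) !=set0.
Proof.
move=> [_ irrA] oU oV [a [Aa Ua]] [b [Ab Vb]]; apply: contrapT => nAUV.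
have [||x Ax|AU|AV] := irrA (~` U) (~` V).
- exact: open_closedC.
- exact: open_closedC.
- rewrite -setCI => UVx; apply: nAUV; by exists x.
- exact: AU a Aa Ua.
- exact: AV b Ab Vb.
Qed.

Section StronglyContinuous.
Context {d : Order.disp_t} {L : porderType d}.
Local Notation S := (strong_scott L).
Context (hL : strongly_continuous_domain L).

Lemma strongly_continuous_locally_compact : locally_compact_space S.
Proof.
move=> x N; rewrite {1}nbhsE => -[U [oU Ux] UN].
have [u [_ xu uU]] := hL.2 U x oU Ux.
exists (up u); split; [exact: xu|exact: cover_compact_up|].
exact: subset_trans UN.
Qed.

(** In a continuous domain with its Scott topology, [x] is interior to [up u]
exactly when [u] is way below [x]; this is the corresponding notion of the
approximants of the points of [A]. *)
Definition approximants (A : set S) : set S :=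
  [set u : S | A `&` interior (up u) !=set0].

(** The interiors of [up u] and [up v] meet [A], hence jointly so at some
[x]; strong continuity at [x] inside their intersection interpolates a common
upper bound of [u] and [v]. *)
Lemma directed_approximants (A : set S) :
  irreducible_set A -> directed (approximants A).
Proof.
move=> irrA; split.
  have [a Aa] := irrA.1; have [u [_ au _]] := hL.2 setT a openT I.
  by exists u, a.
move=> u v Du Dv.
have [x [Ax uvx]] := irreducible_meetI _ _ _ _ irrA
  (open_interior _) (open_interior _) Du Dv.
have [w [[uw vw] xw _]] := hL.2 _ x
  (openI (open_interior _) (open_interior _)) uvx.
exists w; first by exists x.
by split; [exact: interior_subset uw|exact: interior_subset vw].
Qed.

Lemma approximants_sub (A : set S) : closed A -> approximants A `<=` A.
Proof.
move=> cA u [x [Ax /interior_subset ux]]; exact: closed_lower ux.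
Qed.

Lemma strongly_continuous_sober : sober_space S.
Proof.
move=> A cA irrA; have dD := directed_approximants A irrA.
have [s ls] := hL.1 _ dD.
have As : A s by apply: closed_directed_sup ls => //; exact: approximants_sub.
have Acl : A = closure [set (s : S)].
  apply/seteqP; split=> [a Aa N|].
    rewrite nbhsE => -[U [oU Ua] UN].
    have [u [_ au uU]] := hL.2 U a oU Ua.
    exists s; split=> //; apply/UN/uU.
    by apply: ls.1; exists a.
  by rewrite closure_pointE => y ys; exact: closed_lower ys.
exists s; split=> // t; rewrite {1}Acl; exact: closure_point_inj.
Qed.

End StronglyContinuous.

Theorem corollary4p8 (d : Order.disp_t) (L : porderType d)
    (hL : strongly_continuous_domain L) :
  (locally_compact_space (strong_scott L) /\ sober_space (strong_scott L)) /\
  ((exists bot : L, forall x : L, (bot <= x)%O) ->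
    cover_compact [set: strong_scott L]).
Proof.
split; first by split; [exact: strongly_continuous_locally_compact|
                        exact: strongly_continuous_sober].
move=> [bot botP]; have -> : [set: strong_scott L] = up bot.
  by apply/seteqP; split=> // x _; exact: botP.
exact: cover_compact_up.
Qed.
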